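(* Let $n\ge1$. (a) The $\bigsqcup$-irreducible elements of $\widehat{\mathcal F_n}$ and of $\mathcal F_n$ are the same, and the completely meet-irreducible elements of $\widehat{\mathcal F_n}$ and of $\mathcal F_n$ are the same. (b) Any element of $\widehat{\mathcal F_n}$ is a (possibly infinite) union as well as a (possibly infinite) intersection of elements of $\mathcal F_n$.
   Context: Fix $n\ge1$ and symbols $P_1,\dots,P_n$. The partially ordered set $(K_n,\le)$ with valuation map $\mathrm{val}:K_n\to\mathfrak P(\{P_1,\dots,P_n\})$ is the increasing union of finite sets $K_n^d$ ($d\ge 0$) built recursively: $K_n^{-1}=\emptyset$, and $K_n^d\setminus K_n^{d-1}$ consists of exactly one point $w_{\beta,Y}$ for each pair $(\beta,Y)$ such that (i) $Y$ is a decreasing subset of $K_n^{d-1}$ with $Y\not\subseteq K_n^{d-2}$ (for $d=0$ this last condition is void, so $Y=\emptyset$); (ii) $\beta\subseteq\{P_1,\dots,P_n\}$ and $\beta\subseteq\mathrm{val}(w')$ for all $w'\in Y$; (iii) if $Y$ is the decreasing set generated by a single element $w_{\beta',Y'}$, then $\beta\ne\beta'$. One sets $\mathrm{val}(w_{\beta,Y})=\beta$, and $w\le w_{\beta,Y}$ iff $w\in Y$ or $w=w_{\beta,Y}$. $\widehat{\mathcal F_n}:=\mathcal O_\downarrow(K_n,\le)$ is the Heyting algebra of all decreasing subsets of $K_n$ ($\sqcap=\cap$, $\sqcup=\cup$, $a\to b$ = the largest decreasing set contained in $(K_n\setminus a)\cup b$). By a theorem of Bellissima, the Heyting sub-algebra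 of $\widehat{\mathcal F_n}$ generated by $g_i=\{w\in K_n: P_i\in\mathrm{val}(w)\}$, $i=1,\dots,n$, is free on $g_1,\dots,g_n$; the free Heyting algebra $\mathcal F_n$ is identified with it. An element of a lattice is $\bigsqcup$-irreducible (completely join-irreducible) if it cannot be written as a (possibly infinite, possibly empty) join of other elements; it is completely meet-irreducible if it cannot be written as a (possibly infinite, possibly empty) meet of other elements. Joins and meets are taken in the lattice under consideration. *)

(* Defs.v *)
From mathcomp Require Import all_boot all_order finmap.
From mathcomp Require Import boolp classical_sets.

Set Implicit Arguments.
Unset Strict Implicit.
Unset Printing Implicit Defensive.

(* Points are hereditarily finite: w_{beta,Y} is coded by the natural number
   [code beta Y], through an injection from pairs (beta, Y) to nat, where Y is
   itself a finite set of codes. The symbol P_i is i : 'I_n.  On a natural number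
   that codes no pair, [cval] and [cbelow] are empty, which plays no role. *)
Definition code (n : nat) (beta : {set 'I_n}) (Y : {fset nat}) : nat :=
  choice.pickle (beta, Y).

Definition decode (n : nat) (x : nat) : {set 'I_n} * {fset nat} :=
  odflt (finset.set0, fset0) (choice.unpickle x).

Definition cval (n x : nat) : {set 'I_n} := (decode n x).1.

Definition cbelow (n x : nat) : {fset nat} := (decode n x).2.

Definition cle (n : nat) : rel nat := fun x y => (x \in cbelow n y) || (x == y).

Definition decreasing_in (n : nat) (K Y : {fset nat}) : bool :=
  fsubset Y K &&
  [forall y : Y, forall x : K, cle n (val x) (val y) ==> (val x \in Y)].

Definition principal_in (n : nat) (K : {fset nat}) (y : nat) : {fset nat} :=
  [fset x in K | cle n x y]%fset.

(* Conditions (i)-(iii) for w_{beta,Y} to be a point of K^d \ K^{d-1}, where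
   K1 = K^{d-1} and K2 = Some K^{d-2}, or K2 = None when d = 0, in which case
   the requirement that Y is not included in K^{d-2} is void. *)
Definition admissible (n : nat) (K1 : {fset nat}) (K2 : option {fset nat})
    (beta : {set 'I_n}) (Y : {fset nat}) : bool :=
  [&& decreasing_in n K1 Y,
      (if K2 is Some K then ~~ fsubset Y K else true),
      [forall y : Y, beta \subset cval n (val y)]
    & [forall y : Y, (Y == principal_in n K1 (val y)) ==>
                     (beta != cval n (val y))]].

Definition new_points (n : nat) (K1 : {fset nat}) (K2 : option {fset nat}) :
    {fset nat} :=
  [fset code beta Y | beta in {: {set 'I_n}}, Y in fpowerset K1
                    & admissible K1 K2 beta Y]%fset.

(* The index is shifted by one: [Kstage n k] is K_n^{k-1}. *)
Fixpoint Kstage (n k : nat) : {fset nat} :=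
  if k is k1.+1 then
    fsetU (Kstage n k1)
      (new_points n (Kstage n k1)
                  (if k1 is k2.+1 then Some (Kstage n k2) else None))
  else fset0.

Local Open Scope classical_set_scope.

Definition Kpoints (n : nat) : set nat := [set x | exists k, x \in Kstage n k].

Definition Kn (n : nat) : Type := set_type (Kpoints n).

Definition Kle (n : nat) (u v : Kn n) : Prop := cle n (val u) (val v).

Definition Kval (n : nat) (u : Kn n) : {set 'I_n} := cval n (val u).

(* Sets of points are ordered by inclusion, the library order on [set _]. *)
Definition Fhat (n : nat) : set (set (Kn n)) :=
  [set a | forall u v, Kle u v -> a v -> a u].

Definition himp (n : nat) (a b : set (Kn n)) : set (Kn n) :=
  \bigcup_(c in [set c | Fhat c /\ c `<=` ~` a `|` b]) c.

Definition heyting_subalgebra (n : nat) (B : set (set (Kn n))) : Prop :=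
  [/\ B `<=` @Fhat n,
      B set0 /\ B setT,
      forall a b, B a -> B b -> B (a `&` b),
      forall a b, B a -> B b -> B (a `|` b)
    & forall a b, B a -> B b -> B (himp a b)].

Definition gen (n : nat) (i : 'I_n) : set (Kn n) :=
  [set w | i \in Kval w].

Definition Fn (n : nat) : set (set (Kn n)) :=
  smallest (@heyting_subalgebra n) (range (@gen n)).

(* Joins and meets relative to a subset L of an ordered type: these are the
   least upper bound and greatest lower bound within L, which need not be
   those of the whole type (union and intersection for sets). *)
Section RelativeBounds.
Context {d : Order.disp_t} {T : porderType d}.

Definition is_join_in (L S : set T) (a : T) : Prop :=
  (L `&` ubound S) a /\ lbound (L `&` ubound S) a.

Definition is_meet_in (L S : set T) (a : T) : Prop :=
  (L `&` lbound S) a /\ ubound (L `&` lbound S) a.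

Definition completely_join_irreducible (L : set T) : set T :=
  [set a | L a /\ forall S, S `<=` L -> ~ S a -> ~ is_join_in L S a].

Definition completely_meet_irreducible (L : set T) : set T :=
  [set a | L a /\ forall S, S `<=` L -> ~ S a -> ~ is_meet_in L S a].

End RelativeBounds.

(* Main.v *)
(** The points [w_{beta,Y}] of [K_n] are separated by formulas of the de Jongh
    kind.  By induction on [w = w_{beta,Y}], both the principal set [dn w] and the
    complement [nup w] of the increasing set generated by [w] lie in [F_n]: [dn w]
    is the set of points [x] whose value contains [beta] and below which every
    [y] outside [Y] has value exactly [beta] and dominates all of [Y]; and [nup w]
    is the implication from [dn w] to [Y].  That no other [x] occurs is where
    uniqueness of [w_{beta,Y}] and condition (iii) enter, through minimal elements
    of [dn x] outside [Y] and outside [dn w].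
    In any family of decreasing sets containing all [dn w] and all [nup w], the
    completely join-irreducible elements are the [dn w], since [nup w] is the
    largest decreasing set omitting [w]; dually for the [nup w]. *)
Require Import Defs.
From mathcomp Require Import all_boot all_order finmap.
From mathcomp Require Import boolp classical_sets.
Local Open Scope classical_set_scope.

Set Implicit Arguments.
Unset Strict Implicit.
Unset Printing Implicit Defensive.

(** * The order and the valuation of [K_n], on codes *)

Section Points.
Variable n : nat.
Implicit Types (x y z w : nat) (k : nat).

Lemma cle_refl x : cle n x x.
Proof. by rewrite /cle eqxx orbT. Qed.

Lemma codeK (beta : {set 'I_n}) (Y : {fset nat}) : decode n (code beta Y) = (beta, Y).
Proof. by rewrite /decode /code choice.pickleK. Qed.

Lemma Kstage_le k1 k2 x : (k1 <= k2)%N -> x \in Kstage n k1 -> x \in Kstage n k2.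
Proof.
move=> /subnK <-; elim: (k2 - k1)%N => [|m IHm] //= /IHm xK.
by rewrite in_fsetU xK.
Qed.

Lemma new_pointsP (K1 : {fset nat}) (K2 : option {fset nat}) x :
  x \in new_points n K1 K2 ->
  admissible K1 K2 (cval n x) (cbelow n x) /\ code (cval n x) (cbelow n x) = x.
Proof.
case/imfset2P => beta _ [Y]; rewrite !inE => /andP[_ adm] ->.
by rewrite /cval /cbelow codeK.
Qed.

Lemma Kstage_admissible k x : x \in Kstage n k ->
  exists k' K2, [/\ (k' < k)%N, admissible (Kstage n k') K2 (cval n x) (cbelow n x)
    & code (cval n x) (cbelow n x) = x].
Proof.
elim: k => [|k IHk] //=; rewrite in_fsetU => /orP[/IHk[k' [K2 [lt_k' adm eqx]]]|].
  by exists k', K2; split=> //; apply: ltnW.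
by case/new_pointsP => adm eqx; exists k; eexists; split; first exact: ltnSn; eassumption.
Qed.

Lemma decreasing_inP (K Y : {fset nat}) : decreasing_in n K Y ->
  {subset Y <= K} /\ forall x y, y \in Y -> x \in K -> cle n x y -> x \in Y.
Proof.
case/andP => /fsubsetP sYK /forallP decY; split=> // x y yY xK.
by move: (decY [` yY]%fset) => /forallP/(_ [` xK]%fset)/implyP.
Qed.

Lemma cbelow_stage k x y : x \in Kstage n k -> y \in cbelow n x ->
  exists2 k', (k' < k)%N & y \in Kstage n k'.
Proof.
case/Kstage_admissible => k' [K2 [lt_k' /and4P[/decreasing_inP[sub _] _ _ _] _]] /sub.
by exists k'.
Qed.

Lemma Kpoint_below x y : Kpoints n x -> y \in cbelow n x -> Kpoints n y.
Proof. by case=> k xk /(cbelow_stage xk)[k' _ yk]; exists k'. Qed.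

(** Points below [x] occur at strictly earlier stages, so strong induction on the stage index
    applies. *)
Lemma Kpoint_ind (P : nat -> Prop) :
  (forall x, Kpoints n x -> (forall y, y \in cbelow n x -> P y) -> P x) ->
  forall x, Kpoints n x -> P x.
Proof.
move=> IH x [k]; have [m] := ubnP k; elim: m k x => // m IHm k x lt_km xk.
apply: IH => [|y /(cbelow_stage xk)[k' lt_k' yk]]; first by exists k.
exact: IHm (leq_trans lt_k' lt_km) yk.
Qed.

Lemma cbelow_irr x : Kpoints n x -> x \notin cbelow n x.
Proof.
elim/Kpoint_ind => {}x _ IH; apply/negP => xx.
by move: (IH x xx); rewrite xx.
Qed.

Lemma cbelow_trans x y z : Kpoints n x ->
  y \in cbelow n x -> z \in cbelow n y -> z \in cbelow n x.
Proof.
case=> k /Kstage_admissible[k' [K2 [_ /and4P[/decreasing_inP[sub dec] _ _ _] _]]] yx zy.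
(* Admissibility makes [cbelow n x] decreasing only within stage [k'], so [z] must first be placed
   in that stage. *)
have [k2 lt_k2 zk2] := cbelow_stage (sub _ yx) zy.
apply: dec yx _ _; first exact: Kstage_le (ltnW lt_k2) zk2.
by rewrite /cle zy.
Qed.

Lemma cle_trans x y z : Kpoints n z -> cle n x y -> cle n y z -> cle n x z.
Proof.
move=> Kz /orP[xy|/eqP-> //] /orP[yz|/eqP<-]; apply/orP; left=> //.
exact: cbelow_trans yz xy.
Qed.

Lemma Kpoint_le x y : Kpoints n x -> cle n y x -> Kpoints n y.
Proof. by move=> Kx /orP[/(Kpoint_below Kx) //|/eqP->]. Qed.

Lemma cval_mono x y : Kpoints n x -> cle n y x -> cval n x \subset cval n y.
Proof.
case=> k xk /orP[yx|/eqP->] //; have [k' [K2 [_ /and4P[_ _ vle _] _]]] := Kstage_admissible xk.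
exact: (forallP vle [` yx]%fset).
Qed.

Lemma Kpoint_eq x y : Kpoints n x -> Kpoints n y ->
  cval n x = cval n y -> cbelow n x = cbelow n y -> x = y.
Proof.
move=> [k /Kstage_admissible[? [? [_ _ ex]]]] [l /Kstage_admissible[? [? [_ _ ey]]]].
by move=> ev eb; rewrite -[x]ex -[y]ey ev eb.
Qed.

(** Condition (iii) freed from stages: since [cbelow n x] lies in the stage used to build [x], it
    equals the principal set of [w] computed there. *)
Lemma cbelow_principal_cval x w : Kpoints n x ->
  (forall y, (y \in cbelow n x) = cle n y w) -> cval n x <> cval n w.
Proof.
case=> k /Kstage_admissible[k' [K2 [_ /and4P[/decreasing_inP[sub _] _ _ prin] _]]] E.
have wx : w \in cbelow n x by rewrite E cle_refl.
move/forallP: prin => /(_ [` wx]%fset)/implyP H; apply/eqP; apply: H.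
apply/eqP/fsetP => y; rewrite !inE /= -E.
by apply/idP/andP => [yx|[]//]; split=> //; exact: sub.
Qed.

Lemma Kpoint_minimal (P : nat -> Prop) x : Kpoints n x -> P x ->
  exists m, [/\ cle n m x, P m & forall y, y \in cbelow n m -> ~ P y].
Proof.
elim/Kpoint_ind => {}x Kx IH Px.
have [[y [yx Py]]|nex] := pselect (exists y, y \in cbelow n x /\ P y).
  have [m [le_my Pm min_m]] := IH y yx Py; exists m; split=> //.
  by apply: (cle_trans Kx le_my); rewrite /cle yx.
by exists x; split; [exact: cle_refl | | move=> y yx Py; apply: nex; exists y].
Qed.

Lemma cle_characterization w x : Kpoints n w -> Kpoints n x ->
  cval n w \subset cval n x ->
  (forall y, cle n y x -> y \notin cbelow n w ->
     cval n y \subset cval n w /\ {in cbelow n w, forall v, cle n v y}) ->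
  cle n x w.
Proof.
move=> Kw Kx vwx H; apply: contrapT => nxw.
have vE y : cle n y x -> y \notin cbelow n w -> cval n y = cval n w.
  move=> yx yw; apply/eqP; rewrite finset.eqEsubset (proj1 (H _ yx yw)).
  exact: fintype.subset_trans vwx (cval_mono Kx yx).
(* A minimal point outside [cbelow n w] has the same value and the same points below as [w], hence
   is [w]. *)
have wmin m : cle n m x -> m \notin cbelow n w ->
    (forall y, y \in cbelow n m -> y \in cbelow n w) -> m = w.
  move=> mx mw min_m; apply: Kpoint_eq => //; [exact: Kpoint_le mx | exact: vE |].
  apply/fsetP => y; apply/idP/idP => [|yw]; first exact: min_m.
  have /orP[//|/eqP eym] := proj2 (H m mx mw) y yw.
  by rewrite -eym yw in mw.
have w_below m : cle n m x -> m \notin cbelow n w -> cle n w m.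
  move=> mx mw; have Km := Kpoint_le Kx mx.
  have [p [pm pw min_p]] := Kpoint_minimal (P := fun y => y \notin cbelow n w) Km mw.
  rewrite -(wmin p) // ; first exact: cle_trans mx.
  by move=> y yp; apply/negPn/negP; exact: min_p.
(* Exactly the points of the principal set of [w] lie strictly below this [m], yet [m] has the value
   of [w]: condition (iii) forbids it. *)
have [m [mx nmw min_m]] := Kpoint_minimal (P := fun y => ~ cle n y w) Kx nxw.
have Km := Kpoint_le Kx mx.
have mw : m \notin cbelow n w by apply/negP => mw; apply: nmw; rewrite /cle mw.
apply: (@cbelow_principal_cval m w) (vE m mx mw) => // y.
apply/idP/idP => [ym|yw]; first by apply: contrapT => /(min_m y ym).
have /orP[wm|/eqP ewm] := w_below m mx mw; last by case: nmw; rewrite ewm cle_refl.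
case/orP: yw => [yw|/eqP-> //]; exact: cbelow_trans wm yw.
Qed.

End Points.

(** * Principal sets and their dual counterparts in [F_n] *)

Section Separation.
Variable n : nat.
Implicit Types (u v : Kn n) (w : nat) (a b : set (Kn n)).

Definition dn w : set (Kn n) := [set u | cle n (val u) w].

Definition nup w : set (Kn n) := [set u | ~ cle n w (val u)].

Definition points_of (Y : {fset nat}) : set (Kn n) := [set u | val u \in Y].

Lemma KnP u : Kpoints n (val u).
Proof. exact: set_mem (valP u). Qed.

Lemma Kn_val w : Kpoints n w -> exists u, val u = w.
Proof. by move=> Kw; exists (SigSub (mem_set Kw)). Qed.

Lemma Kle_refl u : Kle u u.
Proof. exact: cle_refl. Qed.

Lemma Kle_trans v u u' : Kle u v -> Kle v u' -> Kle u u'.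
Proof. by move=> uv vu'; apply: cle_trans (KnP _) uv vu'. Qed.

(** Kripke form of implication: the right-hand set is decreasing, so it is itself a member of the
    union defining [himp]. *)
Lemma himpE a b : himp a b = [set u | forall v, Kle v u -> a v -> b v].
Proof.
apply/seteqP; split=> [u [c [Fc sc] cu] v vu av|u H].
  by case: (sc v (Fc _ _ vu cu)).
exists [set u | forall v, Kle v u -> a v -> b v] => //; split.
  by move=> x y xy Hy v vx; apply: Hy; exact: Kle_trans xy.
by move=> x Hx; have [ax|] := pselect (a x); [right; exact: Hx (Kle_refl x) ax | left].
Qed.

Lemma himp_Fhat a b : Fhat (himp a b).
Proof. by rewrite himpE => x y xy Hy v vx; apply: Hy; exact: Kle_trans xy. Qed.

Lemma gen_Fhat (i : 'I_n) : Fhat (gen i).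
Proof. by move=> x y xy; exact: (fintype.subsetP (cval_mono (KnP y) xy)). Qed.

Lemma Fhat_heyting : heyting_subalgebra (@Fhat n).
Proof.
split=> //; first by split.
- move=> a b Fa Fb x y xy [ay by_].
  by split; [exact: Fa xy ay | exact: Fb xy by_].
- move=> a b Fa Fb x y xy [ay|by_].
  + by left; exact: Fa xy ay.
  + by right; exact: Fb xy by_.
- by move=> a b _ _; exact: himp_Fhat.
Qed.

Lemma Fn_sub_Fhat : @Fn n `<=` @Fhat n.
Proof. by apply: smallest_sub Fhat_heyting _ => _ [i _ <-]; exact: gen_Fhat. Qed.

Section Subalgebra.
Variable B : set (set (Kn n)).
Hypothesis BH : heyting_subalgebra B.

Lemma heyting_bigU (I : choiceType) (s : seq I) (F : I -> set (Kn n)) :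
  (forall i, i \in s -> B (F i)) -> B (\bigcup_(i in [set` s]) F i).
Proof.
case: BH => _ [B0 _] _ BU _ BF; rewrite bigcup_seq big_seq.
by elim/big_rec: _ => // i a /BF; exact: BU.
Qed.

Lemma heyting_bigI (I : choiceType) (s : seq I) (F : I -> set (Kn n)) :
  (forall i, i \in s -> B (F i)) -> B (\bigcap_(i in [set` s]) F i).
Proof.
case: BH => _ [_ BT] BI _ _ BF; rewrite bigcap_seq big_seq.
by elim/big_rec: _ => // i a /BF; exact: BI.
Qed.

End Subalgebra.

Lemma points_of_bigcup w : Kpoints n w ->
  points_of (cbelow n w) = \bigcup_(v in [set` cbelow n w]) dn v.
Proof.
move=> Kw; apply/seteqP; split=> [u uw|u [v vw]].
  by exists (val u) => //; exact: cle_refl.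
case/orP => [uv|/eqP euv]; last by rewrite /points_of /= euv.
exact: cbelow_trans vw uv.
Qed.

(** Read contrapositively, the implication is the hypothesis of [cle_characterization]. The formula
    is finite and mentions only generators and points strictly below [w], which suits induction. *)
Lemma dnE w : Kpoints n w ->
  dn w = \bigcap_(i in [set` enum (cval n w)]) gen i `&`
         himp (\bigcup_(i in [set` enum (~: cval n w)%SET]) gen i `|`
               \bigcup_(v in [set` cbelow n w]) nup v) (points_of (cbelow n w)).
Proof.
move=> Kw; rewrite himpE; apply/seteqP; split=> [u uw|u [vu H]].
  split=> [i|v vu].
    rewrite /= mem_enum; exact: (fintype.subsetP (cval_mono Kw uw)).
  have /orP[// |/eqP evw] : cle n (val v) w by exact: cle_trans vu uw.
  (* At [w] itself the antecedent fails: [w] lies in no generator outside its value and dominates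
     all of [cbelow n w]. *)
  case=> [[i]|[x xw]]; first by rewrite /= mem_enum inE /gen /= /Kval evw => /negP.
  by case; rewrite evw /cle xw.
apply: cle_characterization (KnP u) _ _ => //.
  by apply/fintype.subsetP => i iw; apply: vu; rewrite /= mem_enum.
move=> y yu; have [v ev] := Kn_val (Kpoint_le (KnP u) yu); rewrite -ev in yu *.
move/negP=> vw; split.
  apply/fintype.subsetP => i iv; apply/negPn/negP => iw; apply/vw/(H v yu); left.
  by exists i => //=; rewrite mem_enum inE.
move=> x xw; apply: contrapT => nxv; apply/vw/(H v yu); right.
by exists x.
Qed.

Lemma nupE w : Kpoints n w -> nup w = himp (dn w) (points_of (cbelow n w)).
Proof.
move=> Kw; rewrite himpE; apply/seteqP; split=> [u nwu v vu|u H wu].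
  by case/orP => // /eqP evw; case: nwu; rewrite -evw.
have [v ev] := Kn_val Kw; subst w.
by move: (H v wu (cle_refl _ _)); rewrite /points_of /= (negPf (cbelow_irr Kw)).
Qed.

(** Both memberships are proved together, since [dnE] at [w] uses [dn] and [nup] of the points below
    [w]. *)
Lemma dn_nup_heyting (B : set (set (Kn n))) w : heyting_subalgebra B ->
  range (@gen n) `<=` B -> Kpoints n w -> B (dn w) /\ B (nup w).
Proof.
move=> BH Bgen; elim/Kpoint_ind => {}w Kw IH.
have Bg i : B (gen i) by apply: Bgen; exists i.
have [_ _ BI BU Bimp] := BH.
have BY : B (points_of (cbelow n w)).
  rewrite points_of_bigcup //; apply: heyting_bigU => // v vw.
  exact: (IH v vw).1.
have Bdn : B (dn w).
  rewrite dnE //; apply: BI; first exact: heyting_bigI.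
  apply: Bimp => //; apply: BU; first exact: heyting_bigU.
  by apply: heyting_bigU => // v vw; exact: (IH v vw).2.
by split=> //; rewrite nupE //; exact: Bimp.
Qed.

Lemma Fn_dn u : Fn (dn (val u)).
Proof. by move=> B [BH Bg]; exact: (dn_nup_heyting BH Bg (KnP u)).1. Qed.

Lemma Fn_nup u : Fn (nup (val u)).
Proof. by move=> B [BH Bg]; exact: (dn_nup_heyting BH Bg (KnP u)).2. Qed.

Lemma dn_le a u : Fhat a -> dn (val u) `<=` a <-> a u.
Proof.
move=> Fa; split=> [|au v vu]; first by apply; exact: cle_refl.
exact: Fa vu au.
Qed.

(** With [dn_le], this yields a splitting pair: a decreasing set either contains [dn (val u)] or is
    contained in [nup (val u)]. *)
Lemma le_nup a u : Fhat a -> a `<=` nup (val u) <-> ~ a u.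
Proof.
move=> Fa; split=> [s /s|nau v av uv]; first by apply; exact: cle_refl.
by apply: nau; exact: Fa uv av.
Qed.

Lemma Fhat_bigcup_dn a : Fhat a ->
  a = \bigcup_(s in [set dn (val u) | u in a]) s.
Proof.
move=> Fa; apply/seteqP; split=> [u au|u [_ [v av <-]]].
  by exists (dn (val u)); [exists u | exact: cle_refl].
exact: (dn_le v Fa).2 av u.
Qed.

Lemma Fhat_bigcap_nup a : Fhat a ->
  a = \bigcap_(s in [set nup (val u) | u in ~` a]) s.
Proof.
move=> Fa; apply/seteqP; split=> [v av _ [u nau <-]|u H].
  exact: (le_nup u Fa).2 nau v av.
apply: contrapT => nau; apply: (H (nup (val u))); first by exists u.
exact: cle_refl.
Qed.

(** * Irreducible elements of a family containing every [dn] and [nup] *)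

Section Irreducibles.
Variable L : set (set (Kn n)).
Hypothesis LF : L `<=` @Fhat n.
Hypothesis Ldn : forall u, L (dn (val u)).
Hypothesis Lnup : forall u, L (nup (val u)).

Lemma dn_not_le_nup u : ~ dn (val u) `<=` nup (val u).
Proof. by move/(le_nup u (LF (Ldn u))); apply; exact: cle_refl. Qed.

Lemma completely_join_irreducibleE :
  completely_join_irreducible L = range (fun u : Kn n => dn (val u)).
Proof.
apply/seteqP; split=> [a [La irr]|_ [u _ <-]].
  have Fa := LF La; apply: contrapT => na.
  (* A non-principal [a] is the join in [L] of the principal sets it contains, all different from
     [a]. *)
  apply: (irr [set dn (val u) | u in a]) => [_ [u _ <-] //||].
    by case=> u _ ea; apply: na; exists u.
  split=> [|b [Lb ub]].
    split=> // _ [u au <-]; rewrite subsetEset; exact/dn_le.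
  rewrite subsetEset => u au.
  have := ub (dn (val u)) (ex_intro2 _ _ u au erefl).
  by rewrite subsetEset; apply; exact: cle_refl.
split=> // S SL nS [[_ ub] lb]; apply: (@dn_not_le_nup u).
(* No member of [S] contains [u], as it would then equal [dn (val u)]. So [nup (val u)] bounds [S]
   in [L], and the join would lie inside it. *)
rewrite -subsetEset; apply: lb; split=> // s Ss; rewrite subsetEset.
have Fs := LF (SL _ Ss); apply/le_nup => // su; apply: nS.
suff <- : s = dn (val u) by [].
by apply/seteqP; split; [rewrite -subsetEset; exact: ub | exact/dn_le].
Qed.

Lemma completely_meet_irreducibleE :
  completely_meet_irreducible L = range (fun u : Kn n => nup (val u)).
Proof.
apply/seteqP; split=> [a [La irr]|_ [u _ <-]].
  have Fa := LF La; apply: contrapT => na.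
  apply: (irr [set nup (val u) | u in ~` a]) => [_ [u _ <-] //||].
    by case=> u _ ea; apply: na; exists u.
  split=> [|b [Lb lb]].
    split=> // _ [u nau <-]; rewrite subsetEset; exact/le_nup.
  rewrite subsetEset => u bu; apply: contrapT => nau.
  have := lb (nup (val u)) (ex_intro2 _ _ u nau erefl).
  by rewrite subsetEset => /(_ u bu); apply; exact: cle_refl.
split=> // S SL nS [[_ lb] ub]; apply: (@dn_not_le_nup u).
(* Dually, a member of [S] omitting [u] would equal [nup (val u)], so [dn (val u)] is a lower bound
   of [S]. *)
rewrite -subsetEset; apply: ub; split=> // s Ss; rewrite subsetEset.
have Fs := LF (SL _ Ss); apply/dn_le => //; apply: contrapT => nsu; apply: nS.
suff <- : s = nup (val u) by [].
by apply/seteqP; split; [exact/le_nup | rewrite -subsetEset; exact: lb].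
Qed.

End Irreducibles.
End Separation.

Theorem corollary4p2 (n : nat) (n_ge1 : (1 <= n)%N) :
  (completely_join_irreducible (@Fhat n) = completely_join_irreducible (@Fn n) /\
   completely_meet_irreducible (@Fhat n) = completely_meet_irreducible (@Fn n)) /\
  (forall a : set (Kn n), @Fhat n a ->
     (exists S : set (set (Kn n)), S `<=` @Fn n /\ a = \bigcup_(s in S) s) /\
     (exists S : set (set (Kn n)), S `<=` @Fn n /\ a = \bigcap_(s in S) s)).
Proof.
have Fdn := @Fn_dn n; have Fnup := @Fn_nup n; have FnFhat := @Fn_sub_Fhat n.
have Hdn u := FnFhat _ (Fdn u); have Hnup u := FnFhat _ (Fnup u).
(* Both sides become the same range, whose description does not depend on the lattice. *)
split; first by split; rewrite ?completely_join_irreducibleE ?completely_meet_irreducibleE.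
move=> a Fa; split.
- exists [set dn (val u) | u in a]; split; last exact: Fhat_bigcup_dn.
  by move=> _ [u _ <-].
- exists [set nup (val u) | u in ~` a]; split; last exact: Fhat_bigcap_nup.
  by move=> _ [u _ <-].
Qed.
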